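(* For every positive integer $n$ with $n\not\equiv 1\pmod 3$, $$2t(1,1,27;n)=r\big(x^2+y^2+27z^2,\,4(8n+29)\big)-r\big(x^2+y^2+27z^2,\,8n+29\big).$$
   Context: For positive integers $a,b,c$ and an integer $n$, $t(a,b,c;n)$ denotes the number of $(x,y,z)\in\mathbb Z^3$ with $a\frac{x(x-1)}2+b\frac{y(y-1)}2+c\frac{z(z-1)}2=n$. For a quadratic form $h$ and integer $m$, $r(h,m)$ denotes the number of integer vectors $v$ with $h(v)=m$. *)

(* Defs.v *)
From mathcomp Require Import all_boot all_order all_algebra.
From mathcomp Require Import finmap.
From mathcomp Require Import mathcomp_extra boolp classical_sets functions cardinality.
From mathcomp Require Import zify.

Set Implicit Arguments.
Unset Strict Implicit.
Unset Printing Implicit Defensive.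

Import Order.TTheory GRing.Theory Num.Theory.
Local Open Scope classical_set_scope.
Local Open Scope ring_scope.

Definition Z3 : choiceType := (int * int * int)%type.

(* fset_set A is the junk value fset0 when A is infinite; the sets counted
   below are finite, see t_set_finite and r_set_finite *)
Definition count_Z3 (A : set Z3) : nat := #|` fset_set A|%fset.

(* the Euclidean quotient is exact here, x (x - 1) being even *)
Definition tri (x : int) : int := (x * (x - 1) %/ 2)%Z.

Definition t_set (a b c n : int) : set Z3 :=
  [set v | let: (x, y, z) := v in a * tri x + b * tri y + c * tri z = n].

Definition t (a b c n : int) : nat := count_Z3 (t_set a b c n).

Definition r_set (h : int -> int -> int -> int) (m : int) : set Z3 :=
  [set v | let: (x, y, z) := v in h x y z = m].

Definition r (h : int -> int -> int -> int) (m : int) : nat :=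
  count_Z3 (r_set h m).

Definition diag_form (a b c : int) (x y z : int) : int :=
  a * x ^+ 2 + b * y ^+ 2 + c * z ^+ 2.

Lemma finite_int_box (B : nat) : finite_set [set x : int | `|x| <= B%:Z].
Proof.
apply: (@sub_finite_set _ _
  ((fun k : nat => k%:Z - B%:Z) @` [set k : nat | (k < (B + B).+1)%N])).
  move=> x /= hx; exists (absz (x + B%:Z)); first by lia.
  by lia.
by apply: finite_image; exact: finite_II.
Qed.

Lemma finite_Z3_box (A : set Z3) (B : nat) :
  (forall x y z, A (x, y, z) ->
     [/\ `|x| <= B%:Z, `|y| <= B%:Z & `|z| <= B%:Z]) ->
  finite_set A.
Proof.
move=> hA; have F := finite_int_box B.
apply: (sub_finite_set _ (finite_setX (finite_setX F F) F)).
by move=> [[x y] z] /hA [].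
Qed.

Lemma tri_ge (x : int) : `|x| - 1 <= tri x.
Proof. by rewrite /tri; nia. Qed.

Lemma tri_ge0 (x : int) : 0 <= tri x.
Proof. by rewrite /tri; nia. Qed.

Lemma t_set_finite (a b c n : int) :
  0 < a -> 0 < b -> 0 < c -> finite_set (t_set a b c n).
Proof.
move=> a0 b0 c0; apply: (@finite_Z3_box _ `|n|.+1) => x y z; rewrite /t_set /=.
have := (tri_ge x, tri_ge y, tri_ge z, (tri_ge0 x, tri_ge0 y, tri_ge0 z)).
move: (tri x) (tri y) (tri z) => X Y Z [[[hx hy] hz] [[hX hY] hZ]] e.
have ha : X <= a * X by nia.
have hb : Y <= b * Y by nia.
have hc : Z <= c * Z by nia.
by split; lia.
Qed.

Lemma r_set_finite (a b c m : int) :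
  0 < a -> 0 < b -> 0 < c -> finite_set (r_set (diag_form a b c) m).
Proof.
move=> a0 b0 c0; apply: (@finite_Z3_box _ `|m|) => x y z.
rewrite /r_set /diag_form /= !expr2 => e.
have sq (u : int) : `|u| <= u * u by nia.
have sq0 (u : int) : 0 <= u * u by nia.
have := (sq x, sq y, sq z, (sq0 x, sq0 y, sq0 z)); move: e {sq sq0}.
move: (x * x) (y * y) (z * z) => X Y Z e [[[hx hy] hz] [[hX hY] hZ]].
have ha : X <= a * X by nia.
have hb : Y <= b * Y by nia.
have hc : Z <= c * Z by nia.
by split; lia.
Qed.

(* Main.v *)
(** Put N = 8n + 29, so that N = 5 mod 8 and N = 0 or 2 mod 3.  Then
    t(1,1,27;n) counts the representations N = u^2 + x^2 + 27 z^2 with u, x, z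
    odd.  In a representation of 4N either all variables are even, which gives
    r(N), or z is odd together with exactly one of the first two variables; so
    r(4N) - r(N) is twice the number of representations
    4N = X^2 + Y^2 + 27 Z^2 with X, Z odd and Y even.

    These two kinds of triples are in bijection.  Let o be a primitive cube
    root of unity and s = sqrt(-3).  For odd x and z, exactly one of o and o^-1
    writes x + 3zs as 2 o^e (w + vs) with integers w, v.  As w + v is odd, this
    turns N into u^2 + 4w^2 + 12v^2, and multiplying the other pair, u + 2vs, by
    a suitable 2 o^e' gives X + 3Zs with X, Z odd and
    X^2 + 27Z^2 + (4w)^2 = 4N.  If 3 does not divide u then divisibility of the
    s-coordinate by 3 determines e'; otherwise 3 divides u, w and v, both signs
    are possible, and the choice e' = e makes the map invertible. *)

Require Import Defs.
From mathcomp Require Import all_boot all_order all_algebra.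
From mathcomp Require Import finmap boolp classical_sets cardinality.
From mathcomp Require Import zify ring.

Set Implicit Arguments.
Unset Strict Implicit.

Import GRing.Theory Num.Theory.
Local Open Scope ring_scope.
Local Open Scope classical_set_scope.

(** * Comparing counts through a relation *)

(** Choice turns [R] into a function from [A] to [B], and the last hypothesis makes it injective.
    Working with a relation lets one formula serve both directions of a bijection. *)
Lemma count_Z3_le (R : Z3 -> Z3 -> Prop) (A B : set Z3) :
  finite_set A -> finite_set B ->
  (forall a, A a -> exists2 b, B b & R a b) ->
  (forall a a' b, A a -> A a' -> B b -> R a b -> R a' b -> a = a') ->
  (count_Z3 A <= count_Z3 B)%N.
Proof.
move=> finA finB totR injR.
have /boolp.choice[f fP] : forall a : Z3, exists b : Z3, A a -> B b /\ R a b.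
  move=> a; have [/totR [b Bb Rab]|nAa] := pselect (A a); first by exists b.
  by exists a.
have inA a : a \in fset_set A -> A a by rewrite in_fset_set // inE.
rewrite /count_Z3.
have <- : #|` [fset f a | a in fset_set A]%fset| = #|` fset_set A|%fset.
  apply: card_in_imfset => a a' /= /inA Aa /inA Aa' eqf.
  have [[Bfa Rafa] [_ Rafa']] := conj (fP a Aa) (fP a' Aa').
  by apply: (injR a a' (f a)) => //; rewrite eqf.
apply: fsubset_leq_card; apply/fsubsetP => _ /imfsetP[a /= /inA Aa ->].
by rewrite in_fset_set // inE; case: (fP a Aa).
Qed.

Lemma count_Z3_eq (R : Z3 -> Z3 -> Prop) (A B : set Z3) :
  finite_set A -> finite_set B ->
  (forall a, A a -> exists2 b, B b & R a b) ->
  (forall b, B b -> exists2 a, A a & R a b) ->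
  (forall a a' b, A a -> A a' -> B b -> R a b -> R a' b -> a = a') ->
  (forall a b b', A a -> B b -> B b' -> R a b -> R a b' -> b = b') ->
  count_Z3 A = count_Z3 B.
Proof.
move=> finA finB totA totB injA injB; apply/eqP; rewrite eqn_leq.
rewrite (@count_Z3_le R) //= (@count_Z3_le (fun b a => R a b)) //.
by move=> b b' a Bb Bb' Aa Rab Rab'; exact: (injB a).
Qed.

Lemma count_Z3_setU (A B : set Z3) :
  finite_set A -> finite_set B -> (forall v, A v -> B v -> False) ->
  count_Z3 (A `|` B) = (count_Z3 A + count_Z3 B)%N.
Proof.
move=> finA finB dAB; rewrite /count_Z3 fset_setU // cardfsU.
rewrite [X in (_ - X)%N](_ : _ = 0%N) ?subn0 //.
apply/eqP; rewrite cardfs_eq0; apply/eqP/fsetP => v.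
rewrite in_fsetI !in_fset_set // in_fset0; apply/negP => /andP[].
by rewrite !inE; exact: dAB.
Qed.

(** * Squares modulo powers of 2 and modulo 3 *)

Lemma consecutive_mul_even (k : int) : exists j, k * (k + 1) = 2 * j.
Proof.
have [m [->|->]] : exists m, k = 2 * m \/ k = 2 * m + 1.
- by exists (k %/ 2)%Z; lia.
- by exists (m * (2 * m + 1)); ring.
- by exists ((2 * m + 1) * (m + 1)); ring.
Qed.

Lemma mulzz_mod8_odd (x : int) : (x %% 2)%Z = 1 -> exists k, x * x = 8 * k + 1.
Proof.
move=> ox; have [k ->] : exists k, x = 2 * k + 1 by exists (x %/ 2)%Z; lia.
have [j ej] := consecutive_mul_even k.
by exists j; lia.
Qed.

Lemma mulzz_mod8_even (x : int) : (x %% 2)%Z = 0 ->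
  exists k, x * x = 16 * k /\ (x %% 4)%Z = 0 \/
            x * x = 32 * k + 4 /\ (x %% 4)%Z = 2.
Proof.
move=> ex; have [k xE] : exists k : int, x = 2 * k by exists (x %/ 2)%Z; lia.
have [ok|ek] : (k %% 2)%Z = 1 \/ (k %% 2)%Z = 0 by lia.
  by have [j ej] := mulzz_mod8_odd ok; exists j; right; split; subst x; lia.
have [j kE] : exists j, k = 2 * j by exists (k %/ 2)%Z; lia.
by exists (j * j); left; split; subst x k; lia.
Qed.

Lemma mulzz_mod3 (x : int) : exists k,
  x * x = 3 * k /\ (x %% 3)%Z = 0 \/ x * x = 3 * k + 1 /\ (x %% 3)%Z <> 0.
Proof.
have [e|[e|e]] : (x %% 3)%Z = 0 \/ (x %% 3)%Z = 1 \/ (x %% 3)%Z = 2 by lia.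
- have [k ->] : exists k, x = 3 * k by exists (x %/ 3)%Z; lia.
  by exists (3 * (k * k)); left; split; lia.
- have [k ->] : exists k, x = 3 * k + 1 by exists (x %/ 3)%Z; lia.
  by exists (3 * (k * k) + 2 * k); right; split; lia.
- have [k ->] : exists k, x = 3 * k + 2 by exists (x %/ 3)%Z; lia.
  by exists (3 * (k * k) + 4 * k + 1); right; split; lia.
Qed.

Lemma diag_formE (a b c x y z : int) :
  diag_form a b c x y z = a * (x * x) + b * (y * y) + c * (z * z).
Proof. by rewrite /diag_form !expr2. Qed.

(** * Representations sorted by parity *)

Definition odd_reps (N : int) : set Z3 :=
  [set v | let: (u, x, z) := v in
    [/\ (u %% 2)%Z = 1, (x %% 2)%Z = 1, (z %% 2)%Z = 1 &
        diag_form 1 1 27 u x z = N]].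

Definition odd_even_odd_reps (M : int) : set Z3 :=
  [set v | let: (x, y, z) := v in
    [/\ (x %% 2)%Z = 1, (y %% 2)%Z = 0, (z %% 2)%Z = 1 &
        diag_form 1 1 27 x y z = M]].

Definition even_odd_odd_reps (M : int) : set Z3 :=
  [set v | let: (x, y, z) := v in
    [/\ (x %% 2)%Z = 0, (y %% 2)%Z = 1, (z %% 2)%Z = 1 &
        diag_form 1 1 27 x y z = M]].

Definition even_reps (M : int) : set Z3 :=
  [set v | let: (x, y, z) := v in
    [/\ (x %% 2)%Z = 0, (y %% 2)%Z = 0, (z %% 2)%Z = 0 &
        diag_form 1 1 27 x y z = M]].

Lemma finite_reps (A : set Z3) (M : int) :
  A `<=` r_set (diag_form 1 1 27) M -> finite_set A.
Proof. by move=> sAr; apply: (sub_finite_set sAr); exact: r_set_finite. Qed.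

Lemma finite_odd_reps (N : int) : finite_set (odd_reps N).
Proof. by apply: (@finite_reps _ N) => -[[u x] z] []. Qed.

Lemma finite_odd_even_odd_reps (M : int) : finite_set (odd_even_odd_reps M).
Proof. by apply: (@finite_reps _ M) => -[[u x] z] []. Qed.

Lemma finite_even_odd_odd_reps (M : int) : finite_set (even_odd_odd_reps M).
Proof. by apply: (@finite_reps _ M) => -[[u x] z] []. Qed.

Lemma finite_even_reps (M : int) : finite_set (even_reps M).
Proof. by apply: (@finite_reps _ M) => -[[u x] z] []. Qed.

Lemma triE (x : int) : (2 * x - 1) * (2 * x - 1) = 8 * tri x + 1.
Proof.
have [k kE] := consecutive_mul_even (x - 1).
have {}kE : x * (x - 1) = k * 2 by lia.
by rewrite /tri kE mulzK //; lia.
Qed.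

(** Multiplying by 8 and adding 29 = 1 + 1 + 27 completes the three squares. *)
Lemma t_odd_reps (n : int) : t 1 1 27 n = count_Z3 (odd_reps (8 * n + 29)).
Proof.
apply: (@count_Z3_eq (fun a b => let: (x, y, z) := a in
                     b = (2 * x - 1, 2 * y - 1, 2 * z - 1))).
- exact: t_set_finite.
- exact: finite_odd_reps.
- move=> [[x y] z] /= e; exists (2 * x - 1, 2 * y - 1, 2 * z - 1) => //=.
  by rewrite diag_formE !triE; split; lia.
- move=> [[u x] z] /= [ou ox oz]; rewrite diag_formE.
  have [u' ->] : exists k, u = 2 * k - 1 by exists ((u + 1) %/ 2)%Z; lia.
  have [x' ->] : exists k, x = 2 * k - 1 by exists ((x + 1) %/ 2)%Z; lia.
  have [z' ->] : exists k, z = 2 * k - 1 by exists ((z + 1) %/ 2)%Z; lia.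
  by rewrite !triE => e; exists (u', x', z') => //=; lia.
- move=> [[x y] z] [[x' y'] z'] b _ _ _ -> [e1 e2 e3].
  by congr (_, _, _); lia.
- by move=> [[x y] z] b b' _ _ _ -> ->.
Qed.

Lemma r_even_reps (N : int) :
  r (diag_form 1 1 27) N = count_Z3 (even_reps (4 * N)).
Proof.
apply: (@count_Z3_eq (fun a b => let: (x, y, z) := a in
                     b = (2 * x, 2 * y, 2 * z))).
- exact: r_set_finite.
- exact: finite_even_reps.
- move=> [[x y] z] /=; rewrite diag_formE => e.
  exists (2 * x, 2 * y, 2 * z) => //=.
  by rewrite diag_formE; split; lia.
- move=> [[u x] z] /= [ou ox oz]; rewrite diag_formE.
  have [u' ->] : exists k, u = 2 * k by exists (u %/ 2)%Z; lia.
  have [x' ->] : exists k : int, x = 2 * k by exists (x %/ 2)%Z; lia.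
  have [z' ->] : exists k, z = 2 * k by exists (z %/ 2)%Z; lia.
  by move=> e; exists (u', x', z') => //=; rewrite diag_formE; lia.
- move=> [[x y] z] [[x' y'] z'] b _ _ _ -> [e1 e2 e3].
  by congr (_, _, _); lia.
- by move=> [[x y] z] b b' _ _ _ -> ->.
Qed.

Lemma count_even_odd_odd_reps (M : int) :
  count_Z3 (even_odd_odd_reps M) = count_Z3 (odd_even_odd_reps M).
Proof.
apply: (@count_Z3_eq (fun a b => let: (x, y, z) := a in b = (y, x, z))).
- exact: finite_even_odd_odd_reps.
- exact: finite_odd_even_odd_reps.
- move=> [[x y] z] /= [ex oy oz]; rewrite diag_formE => e.
  by exists (y, x, z) => //=; rewrite diag_formE; split; lia.
- move=> [[x y] z] /= [ox ey oz]; rewrite diag_formE => e.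
  by exists (y, x, z) => //=; rewrite diag_formE; split; lia.
- by move=> [[x y] z] [[x' y'] z'] b _ _ _ -> [-> -> ->].
- by move=> [[x y] z] b b' _ _ _ -> ->.
Qed.

(** Modulo 4 the equation reads X^2 + Y^2 = Z^2: if Z is even so are X and Y, and if Z is odd
    exactly one of X, Y is odd. *)
Lemma r_4mul (N : int) : r (diag_form 1 1 27) (4 * N) =
  (r (diag_form 1 1 27) N + 2 * count_Z3 (odd_even_odd_reps (4 * N)))%N.
Proof.
(* One of the two equal counts is swapped to the other class, so that the sum counts a disjoint
   union. *)
rewrite (r_even_reps N) mul2n -addnn -{1}count_even_odd_odd_reps.
have finU := finite_setU.
rewrite -!count_Z3_setU ?finU; try by
  [exact: finite_even_reps | exact: finite_even_odd_odd_reps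
  | exact: finite_odd_even_odd_reps
  | split; [exact: finite_even_odd_odd_reps | exact: finite_odd_even_odd_reps]].
- congr count_Z3; apply/seteqP; split=> [[[x y] z]|[[x y] z]] /=; last first.
    by move=> [|[]] [].
  move=> e; move: (e); rewrite diag_formE => e'.
  have sq (v : int) : exists k, v * v = 4 * k /\ (v %% 2)%Z = 0 \/
                                v * v = 4 * k + 1 /\ (v %% 2)%Z = 1.
    have [ev|ov] : (v %% 2)%Z = 0 \/ (v %% 2)%Z = 1 by lia.
      by have [k [[ek _]|[ek _]]] := mulzz_mod8_even ev;
        [exists (4 * k) | exists (8 * k + 1)]; left; split; lia.
    by have [k ek] := mulzz_mod8_odd ov; exists (2 * k); right; split; lia.
  have [[i hi] [j hj] [k hk]] := And3 (sq x) (sq y) (sq z).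
  have [h|[h|h]] : ((x %% 2)%Z = 0 /\ (y %% 2)%Z = 0 /\ (z %% 2)%Z = 0) \/
    ((x %% 2)%Z = 0 /\ (y %% 2)%Z = 1 /\ (z %% 2)%Z = 1) \/
    ((x %% 2)%Z = 1 /\ (y %% 2)%Z = 0 /\ (z %% 2)%Z = 1) by lia.
  + by left; case: h => ? [].
  + by right; left; case: h => ? [].
  + by right; right; case: h => ? [].
- by move=> [[x y] z] /= [? ? ? _] [] []; lia.
- by move=> [[x y] z] /= [? ? ? _] []; lia.
Qed.

(** * The correspondence between the two kinds of triples *)

(* For e = 1 or -1: x + y s = 2 o^e (w + v s). *)
Definition twist (e w v x y : int) : Prop :=
  x = - w - 3 * e * v /\ y = e * w - v.

(** The s-coordinates are 3z and 3z' because x^2 + 27z^2 is the norm of x + 3zs. The last clause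
    fixes the sign that stays free when 3 divides u. *)
Definition linked (a b : Z3) : Prop :=
  let: (u, x, z) := a in let: (x', y, z') := b in
  exists v w e e' : int,
    [/\ (e = 1 \/ e = -1) /\ (e' = 1 \/ e' = -1), y = 4 * w,
        twist e w v x (3 * z), twist e' u (2 * v) x' (3 * z') &
        (u %% 3)%Z = 0 -> e = e'].

Lemma odd_reps_linked (N : int) (a : Z3) : (N %% 3)%Z <> 1 -> odd_reps N a ->
  exists2 b, odd_even_odd_reps (4 * N) b & linked a b.
Proof.
case: a => [[u x] z] hN [ou ox oz]; rewrite diag_formE => eN.
have [[i hi] [j hj]] := conj (mulzz_mod3 u) (mulzz_mod3 x).
(* Modulo 3, N = u^2 + x^2, which would be 1 if 3 divided exactly one of u, x. *)
have hux : (u %% 3)%Z = 0 /\ (x %% 3)%Z = 0 \/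
           (u %% 3)%Z <> 0 /\ (x %% 3)%Z <> 0.
  by clear - hN eN hi hj; lia.
clear i hi j hj.
have [e [w [v [he hx hz]]]] : exists e w v : int,
    [/\ e = 1 \/ e = -1, x = - w - 3 * e * v & 3 * z = e * w - v].
  (* Solving for w and v divides by 4; this is exact for e = 1 when x = z modulo 4, and for e = -1
     when x = -z. *)
  have [h|h] : (x %% 4)%Z = (z %% 4)%Z \/ (x %% 4)%Z <> (z %% 4)%Z by lia.
    by exists 1, ((- x + 9 * z) %/ 4)%Z, ((- x - 3 * z) %/ 4)%Z; split; lia.
  by exists (-1), ((- x - 9 * z) %/ 4)%Z, ((x - 3 * z) %/ 4)%Z; split; lia.
have [e' [z' [he' hz' hee']]] : exists e' z' : int,
    [/\ e' = 1 \/ e' = -1, 3 * z' = e' * u - 2 * v & (u %% 3)%Z = 0 -> e = e'].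
  clear eN hN.
  (* If 3 divides u, it divides x, w and v, and any sign works; otherwise u and v are units modulo
     3, so u = 2v or u = -2v. *)
  have [h|h] : (u %% 3)%Z = 0 \/ (u %% 3)%Z <> 0 by lia.
    by exists e, ((e * u - 2 * v) %/ 3)%Z; case: he => ?; subst e; split; lia.
  have [h'|h'] : (u %% 3)%Z = ((2 * v) %% 3)%Z \/
                 (u %% 3)%Z <> ((2 * v) %% 3)%Z by lia.
    by exists 1, ((u - 2 * v) %/ 3)%Z; split; lia.
  by exists (-1), ((- u - 2 * v) %/ 3)%Z; case: he => ?; subst e; split; lia.
exists (- u - 6 * e' * v, 4 * w, z'); last first.
  by exists v, w, e, e'; split=> //; split=> //; lia.
clear hux hee'.
rewrite /= diag_formE; split.
- by clear eN hN; case: he' => ?; subst e'; lia.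
- by clear; lia.
- by clear eN hN; case: he' => ?; subst e'; lia.
(* Only 3z' and 3z are known linearly, so the squares are scaled by 3 before substituting. *)
- have q : 3 * (27 * (z' * z')) = 9 * ((3 * z') * (3 * z')) by ring.
  have q' : 3 * (27 * (z * z)) = 9 * ((3 * z) * (3 * z)) by ring.
  rewrite hz' in q; rewrite hz in q'; rewrite hx in eN.
  by case: he he' => ? [] ?; subst e e'; lia.
Qed.

Lemma linked_odd_reps (N : int) (b : Z3) :
  (N %% 8)%Z = 5 -> (N %% 3)%Z <> 1 -> odd_even_odd_reps (4 * N) b ->
  exists2 a, odd_reps N a & linked a b.
Proof.
case: b => [[x y] z] hN8 hN [ox ey oz]; rewrite diag_formE => eN.
have [[i hi] [j hj]] := conj (mulzz_mod3 x) (mulzz_mod3 y).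
have hxy : (x %% 3)%Z = 0 /\ (y %% 3)%Z = 0 \/
           (x %% 3)%Z <> 0 /\ (y %% 3)%Z <> 0.
  by clear - hN eN hi hj; lia.
clear i hi j hj.
have [w yE] : exists w, y = 4 * w.
  exists (y %/ 4)%Z.
  (* If y were 2 modulo 4, the form would be 1 + 27 + 4 = 0 modulo 8, but 4N = 4. *)
  have [[i hi] [k hk]] := conj (mulzz_mod8_odd ox) (mulzz_mod8_odd oz).
  have [j [[_ y4]|[hj _]]] := mulzz_mod8_even ey; first by clear - y4; lia.
  by rewrite hi hj hk in eN; clear - eN hN8; lia.
have [e' [u [v2 [he' hx hz]]]] : exists e' u v2 : int,
    [/\ e' = 1 \/ e' = -1, x = - u - 3 * e' * v2 & 3 * z = e' * u - v2].
  have [h|h] : (x %% 4)%Z = (z %% 4)%Z \/ (x %% 4)%Z <> (z %% 4)%Z by lia.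
    by exists 1, ((- x + 9 * z) %/ 4)%Z, ((- x - 3 * z) %/ 4)%Z; split; lia.
  by exists (-1), ((- x - 9 * z) %/ 4)%Z, ((x - 3 * z) %/ 4)%Z; split; lia.
have eN' : u * u + 4 * (w * w) + 3 * (v2 * v2) = N.
  have q : 3 * (27 * (z * z)) = 9 * ((3 * z) * (3 * z)) by ring.
  rewrite hz in q; rewrite hx yE in eN.
  by case: he' => ?; subst e'; lia.
clear eN.
have uv2 : (u %% 2)%Z = 1 /\ (v2 %% 2)%Z = 0.
  have [//|[ou ev]] : ((u %% 2)%Z = 1 /\ (v2 %% 2)%Z = 0) \/
    ((u %% 2)%Z = 0 /\ (v2 %% 2)%Z = 1).
    by clear - he' ox oz hx hz; case: he' => ?; subst e'; lia.
  (* With u even and v2 odd, N would be 3 modulo 4. *)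
  have [[i hi] [k hk]] := conj (mulzz_mod8_even ou) (mulzz_mod8_odd ev).
  by rewrite hk in eN'; clear - eN' hN8 hi; lia.
case: uv2 => ou ev2.
have [v v2E] : exists v, v2 = 2 * v by exists (v2 %/ 2)%Z; lia.
subst v2 y.
(* Modulo 8, N = 1 + 4(w + v), and N = 5. This makes x and z odd in the preimage. *)
have owv : ((w + v) %% 2)%Z = 1.
  have [i hi] := mulzz_mod8_odd ou.
  have [//|h] : ((w + v) %% 2)%Z = 1 \/ ((w + v) %% 2)%Z = 0 by lia.
  have [k kE] : exists k, w = 2 * k - v by exists ((w + v) %/ 2)%Z; lia.
  by rewrite hi kE in eN'; clear - eN' hN8; lia.
have [e [z0 [he hz0 hee']]] : exists e z0 : int,
    [/\ e = 1 \/ e = -1, 3 * z0 = e * w - v & (u %% 3)%Z = 0 -> e = e'].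
  clear eN' hN hN8.
  have [h|h] : (u %% 3)%Z = 0 \/ (u %% 3)%Z <> 0 by lia.
    by exists e', ((e' * w - v) %/ 3)%Z; case: he' => ?; subst e'; split; lia.
  have [h'|h'] : (w %% 3)%Z = (v %% 3)%Z \/ (w %% 3)%Z <> (v %% 3)%Z by lia.
    by exists 1, ((w - v) %/ 3)%Z; split; lia.
  by exists (-1), ((- w - v) %/ 3)%Z; case: he' => ?; subst e'; split; lia.
exists (u, - w - 3 * e * v, z0); last first.
  by exists v, w, e, e'; split=> //; split=> //; lia.
clear hx hz hxy hee' he'.
rewrite /= diag_formE; split=> //.
- by clear eN' hN hN8; case: he => ?; subst e; lia.
- by clear eN' hN hN8; case: he => ?; subst e; lia.
- have q' : 3 * (27 * (z0 * z0)) = 9 * ((3 * z0) * (3 * z0)) by ring.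
  rewrite hz0 in q'.
  by case: he => ?; subst e; lia.
Qed.

Lemma linked_inj_left (N M : int) (a a' b : Z3) :
  odd_reps N a -> odd_reps N a' -> odd_even_odd_reps M b ->
  linked a b -> linked a' b -> a = a'.
Proof.
case: a a' b => [[u1 x1] z1] [[u2 x2] z2] [[x y] z].
move=> [ou1 _ _ _] [ou2 _ _ _] _.
move=> [v1 [w1 [e1 [f1 [[he1 hf1] hy1 [hx1 hz1] [hX1 hZ1] hef1]]]]].
move=> [v2 [w2 [e2 [f2 [[he2 hf2] hy2 [hx2 hz2] [hX2 hZ2] hef2]]]]].
have wE : w1 = w2 by lia.
(* Opposite signs would give x = z and x = -z modulo 4, although z is odd. *)
have fE : f1 = f2 by case: hf1 hf2 => ? [] ?; subst f1 f2 => //; lia.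
have [uE vE] : u1 = u2 /\ v1 = v2 by case: hf1 => ?; subst f1 f2; lia.
subst w2 f2 u2 v2.
have eE : e1 = e2.
  have [h|h] : (u1 %% 3)%Z = 0 \/ (u1 %% 3)%Z <> 0 by lia.
    by rewrite hef1 // hef2.
  (* Opposite signs would make 3 divide w and v, hence u. *)
  by case: he1 he2 hf1 => ? [] ? [] ?; subst e1 e2 f1 => //; lia.
by subst e2; congr (_, _, _); lia.
Qed.

Lemma linked_inj_right (N M : int) (a b b' : Z3) :
  odd_reps N a -> odd_even_odd_reps M b -> odd_even_odd_reps M b' ->
  linked a b -> linked a b' -> b = b'.
Proof.
case: a b b' => [[u x] z] [[x1 y1] z1] [[x2 y2] z2].
move=> [ou ox oz _] _ _.
move=> [v1 [w1 [e1 [f1 [[he1 hf1] hy1 [hx1 hz1] [hX1 hZ1] hef1]]]]].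
move=> [v2 [w2 [e2 [f2 [[he2 hf2] hy2 [hx2 hz2] [hX2 hZ2] hef2]]]]].
have eE : e1 = e2 by case: he1 he2 => ? [] ?; subst e1 e2 => //; lia.
have [wE vE] : w1 = w2 /\ v1 = v2 by case: he1 => ?; subst e1 e2; lia.
subst w2 e2 v2.
have fE : f1 = f2.
  have [h|h] : (u %% 3)%Z = 0 \/ (u %% 3)%Z <> 0 by lia.
    by rewrite -hef1 // -hef2.
  by case: hf1 hf2 => ? [] ?; subst f1 f2 => //; lia.
by subst f2; congr (_, _, _); lia.
Qed.

Lemma count_odd_reps (N : int) : (N %% 8)%Z = 5 -> (N %% 3)%Z <> 1 ->
  count_Z3 (odd_reps N) = count_Z3 (odd_even_odd_reps (4 * N)).
Proof.
move=> hN8 hN3; apply: (@count_Z3_eq linked).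
- exact: finite_odd_reps.
- exact: finite_odd_even_odd_reps.
- by move=> a; exact: odd_reps_linked.
- by move=> b; exact: linked_odd_reps.
- by move=> a a' b; exact: linked_inj_left.
- by move=> a b b'; exact: linked_inj_right.
Qed.

Theorem theorem3p8 (n : int) (hn : 0 < n) (hn3 : (n <> 1 %[mod 3])%Z) :
  2 * (t 1 1 27 n)%:Z =
    (r (diag_form 1 1 27) (4 * (8 * n + 29)))%:Z
    - (r (diag_form 1 1 27) (8 * n + 29))%:Z.
Proof.
rewrite r_4mul t_odd_reps count_odd_reps; [by lia | by lia |].
(* 8n + 29 = 2n + 2 modulo 3, which is 1 exactly when n is. *)
by move: hn3; rewrite /=; lia.
Qed.
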